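(* Let $N\ge0$ be an integer and $\alpha,\beta$ real parameters, and let $|e_n\rangle,|e_n^*\rangle,|d_n\rangle,|d_n^*\rangle$ ($n=0,\dots,N$) be the vectors defined in the context. Put $$a=\alpha-\beta,\qquad b=N-2\beta-1,$$ and assume the parameters are generic, i.e. $\mu_0,\dots,\mu_N$ are pairwise distinct and all expressions below are defined (no denominator vanishes). Then for all $m,n=0,\dots,N$ the functions $U_m(n)=\langle e_m|d_n^*\rangle$ and $\tilde U_m(n)=\langle e_m^*|Z|d_n\rangle$ are given by $$U_m(n)=\frac{a_0\cdots a_{n-1}}{a_0\cdots a_{m-1}}\,\frac{(1-a)_n(1+b)_m}{n!\,(m+b-N)_m}\,\mathcal U_m(n;a,b,N),$$ $$\tilde U_m(n)=-\frac{a_n\cdots a_{N-1}}{a_m\cdots a_{N-1}}\,\frac{(m+1)_{N-m}(a-b-1)_{N-n}}{(N-n)!\,(-N)_m(-b)_{N-2m}}\,\mathcal V_m(n;a,b,N),$$ where $\mathcal U_m,\mathcal V_m$ are the rational functions of Hahn type.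
   Context: $\mathcal M$ is the real vector space with orthonormal basis $\{|n\rangle:n=0,\dots,N\}$ ($\langle\ell|k\rangle=\delta_{\ell,k}$); ${}^\top$ denotes transpose in this basis. $a_0,\dots,a_{N-1}$ are nonzero real constants and $a_N=0$ (not to be confused with the parameter $a$). The operators $Z,X,V$ (a representation of the meta Hahn algebra) are $$Z|n\rangle=-|n\rangle+a_n|n+1\rangle,\qquad X|n\rangle=(n-\alpha)|n\rangle-a_n(n-\beta)|n+1\rangle,$$ $$V|n\rangle=(\beta-n)(n-\beta-1)|n\rangle-\frac{n(N+1-n)}{a_{n-1}}|n-1\rangle$$ (terms $|N+1\rangle$ for $n=N$ and $|-1\rangle$ for $n=0$ are absent). With $\mu_n=(\beta-n)(n-\beta-1)$ and $\lambda_n=\alpha-n$, the vectors are the solutions of $$V|e_n\rangle=\mu_n|e_n\rangle,\quad V^\top|e_n^*\rangle=\mu_n|e_n^*\rangle,\quad X|d_n\rangle=\lambda_nZ|d_n\rangle,\quad X^\top|d_n^*\rangle=\lambda_nZ^\top|d_n^*\rangle,$$ normalized so that the coefficient of $|n\rangle$ in each of $|e_n\rangle,|e_n^*\rangle,|d_n\rangle,|d_n^*\rangle$ is $1$. Rational functions of Hahn type: for $m=0,\dots,N$, $$\mathcal U_m(x;a,b,N)=\frac{(-1)^m(-N)_m}{(b+1)_m}\sum_{\ell=0}^m\frac{(-x)_\ell(-m)_\ell(b+m-N)_\ell}{\ell!\,(-N)_\ell(a-x)_\ell},\qquad \mathcal V_m(x;a,b,N)=\mathcal U_m(N-x;b+2-a,b,N)$$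 (the sum is ${}_3F_2(-x,-m,b+m-N;-N,a-x;1)$). Pochhammer symbols: $(x)_0=1$, $(x)_k=x(x+1)\cdots(x+k-1)$ for $k\ge1$, and for negative index $(x)_{-k}=1/(x-k)_k$ (i.e. $(x)_j=\Gamma(x+j)/\Gamma(x)$). Empty products of the $a_j$ equal $1$. *)

(* Defs.v *)
From HB Require Import structures.
From mathcomp Require Export all_boot all_order all_algebra.
From mathcomp Require Export reals.

Set Implicit Arguments.
Unset Strict Implicit.
Unset Printing Implicit Defensive.

Import Order.TTheory GRing.Theory Num.Theory.
Local Open Scope ring_scope.

Section MetaHahn.
Variable R : realType.

Definition poch (x : R) (k : nat) : R := \prod_(i < k) (x + i%:R).

(* (x)_j = Gamma(x + j) / Gamma(x) for j in Z: (x)_{-k} = 1 / (x - k)_k.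
   As 0^-1 = 0 in R, pochz x j <> 0 says exactly that (x)_j is defined
   and nonzero, whatever the sign of j. *)
Definition pochz (x : R) (j : int) : R :=
  match j with
  | Posz k => poch x k
  | Negz k => (poch (x - k.+1%:R) k.+1)^-1
  end.

Definition mu (beta : R) (n : nat) : R := (beta - n%:R) * (n%:R - beta - 1).

Definition lambda (alpha : R) (n : nat) : R := alpha - n%:R.

(* Operators are matrices acting on column vectors, so that entry (i, j) is
   <i| _ |j>: column j is the image of |j>. The indices 0..N being those of
   'I_N.+1, the terms in |N+1> and |-1> are absent. *)
Definition opZ (N : nat) (a_ : nat -> R) : 'M[R]_N.+1 :=
  \matrix_(i, j) (- (i == j)%:R + a_ j * (i == j.+1 :> nat)%:R).

Definition opX (N : nat) (a_ : nat -> R) (alpha beta : R) : 'M[R]_N.+1 :=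
  \matrix_(i, j) ((j%:R - alpha) * (i == j)%:R
                  - a_ j * (j%:R - beta) * (i == j.+1 :> nat)%:R).

Definition opV (N : nat) (a_ : nat -> R) (beta : R) : 'M[R]_N.+1 :=
  \matrix_(i, j) ((beta - j%:R) * (j%:R - beta - 1) * (i == j)%:R
    - j%:R * (N.+1%:R - j%:R) / a_ j.-1 * (i.+1 == j :> nat)%:R).

Definition braket (N : nat) (u v : 'cV[R]_N.+1) : R := (u^T *m v) 0 0.

(* The sum is 3F2(-x, -m, b+m-N; -N, a-x; 1), which terminates at l = m. *)
Definition hahnU (m : nat) (x a b : R) (N : nat) : R :=
  (-1) ^+ m * poch (- N%:R) m / poch (b + 1) m *
  \sum_(l < m.+1)
    (poch (- x) l * poch (- m%:R) l * poch (b + m%:R - N%:R) l)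
    / (l`!%:R * poch (- N%:R) l * poch (a - x) l).

Definition hahnV (m : nat) (x a b : R) (N : nat) : R :=
  hahnU m (N%:R - x) (b + 2 - a) b N.

(* No denominator in the formula for hahnU m x a b N (resp. hahnV) vanishes. *)
Definition hahnU_defined (m : nat) (x a b : R) (N : nat) : Prop :=
  poch (b + 1) m != 0 /\
  forall l : nat, (l <= m)%N ->
    l`!%:R * poch (- N%:R) l * poch (a - x) l != 0.

Definition hahnV_defined (m : nat) (x a b : R) (N : nat) : Prop :=
  hahnU_defined m (N%:R - x) (b + 2 - a) b N.

End MetaHahn.

(* Main.v *)
Require Import Defs.
From mathcomp Require Import all_boot all_order all_algebra reals.
From mathcomp Require Import ring zify.

Import Order.TTheory GRing.Theory Num.Theory.
Local Open Scope ring_scope.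

(* In the basis |n> all four eigenvalue problems are bidiagonal, so two-term
   recurrences solve them in closed form. The overlap <e_m|d_n^*> is then term
   by term the series defining hahnU. The overlap <e_m^*|Z|d_n>, summed from
   the top index N downwards, is instead a 3F2 with upper parameters n-N, m-N,
   -b-m. It is brought to hahnV by the transformation
     (E)_M 3F2(-M, A, B; D, E; 1)
       = (D+E-A-B)_M 3F2(-M, D-A, D-B; D, D+E-A-B; 1),
   which is the coefficient of z^M in Euler's transformation
     2F1(A, B; D; z) = (1-z)^(D-A-B) 2F1(D-A, D-B; D; z)
   multiplied by a power of 1-z. *)

(** * Pochhammer symbols, binomial series and Euler's transformation *)

Section Pochhammer.
Set Implicit Arguments.
Unset Strict Implicit.
Variable R : realType.
Implicit Types (x y c s A B D : R) (i j k l m n : nat).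

Lemma poch0 x : poch x 0 = 1.
Proof. by rewrite /poch big_ord0. Qed.

Lemma pochS x k : poch x k.+1 = poch x k * (x + k%:R).
Proof. by rewrite /poch big_ord_recr. Qed.

Lemma poch1 x : poch x 1 = x.
Proof. by rewrite pochS poch0 mul1r addr0. Qed.

Lemma pochD x m n : poch x (m + n) = poch x m * poch (x + m%:R) n.
Proof.
elim: n => [|n IHn]; first by rewrite addn0 poch0 mulr1.
by rewrite addnS !pochS IHn natrD mulrA addrA.
Qed.

(** The factors on the left are those of [poch x k] in reverse order, each with its sign changed. *)
Lemma poch_refl x k : poch (1 - x - k%:R) k = (-1) ^+ k * poch x k.
Proof.
elim: k x => [|k IHk] x; first by rewrite !poch0 mulr1.
rewrite [in RHS]pochS exprS -[in LHS]add1n pochD poch1 add1n.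
have -> : 1 - x - k.+1%:R + 1%:R = 1 - x - k%:R by rewrite -natr1; ring.
by rewrite IHk -natr1; ring.
Qed.

Lemma poch_oppn_eq0 n k : (poch (- n%:R : R) k == 0) = (n < k)%N.
Proof.
rewrite /poch; have [le_kn|lt_nk] := leqP k n.
  apply/negbTE/prodf_neq0 => i _; rewrite addrC subr_eq0 eqr_nat.
  by rewrite neq_ltn (leq_trans (ltn_ord i)).
by rewrite (bigD1 (Ordinal lt_nk)) //= addNr mul0r eqxx.
Qed.

Lemma poch_oppn n k : (k <= n)%N ->
  poch (- n%:R : R) k * (n - k)`!%:R = (-1) ^+ k * n`!%:R.
Proof.
elim: k => [|k IHk] lt_kn; first by rewrite poch0 subn0 !mul1r.
have := IHk (ltnW lt_kn); rewrite -[(n - k)%N](subnSK lt_kn) factS.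
rewrite natrM subnSK // natrB 1?ltnW // pochS exprS => E.
by rewrite mulN1r mulNr -E; ring.
Qed.

Lemma fact_neq0 n : n`!%:R != 0 :> R.
Proof. by rewrite pnatr_eq0 -lt0n fact_gt0. Qed.

Lemma poch_fact m n : (m <= n)%N ->
  m`!%:R * poch (m%:R + 1 : R) (n - m) = n`!%:R.
Proof.
move=> /subnK <-; rewrite addnK.
elim: (n - m)%N => [|k IHk]; first by rewrite poch0 mulr1.
by rewrite pochS mulrA IHk addSn factS natrM -natr1 natrD; ring.
Qed.

(* The coefficient of z^(n - i) in (1 - z)^(-c). *)
Definition negbin c n i : R :=
  if (i <= n)%N then poch c (n - i) / (n - i)`!%:R else 0.

Lemma negbinnn c n : negbin c n n = 1.
Proof. by rewrite /negbin leqnn subnn poch0 divr1. Qed.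

Lemma negbin_gt c n i : (n < i)%N -> negbin c n i = 0.
Proof. by rewrite /negbin ltnNge => /negbTE ->. Qed.

(** Both differences are taken in [R], so no bound on [i] is needed: where the truncated coefficient
    jumps from 0 to 1, at i = n + 1, the factor on the left vanishes. *)
Lemma negbinS c n i :
  (n.+1%:R - i%:R) * negbin c n.+1 i = (c + n%:R - i%:R) * negbin c n i.
Proof.
rewrite /negbin; have [le_in|lt_ni] := leqP i n.
  rewrite (leq_trans le_in) // subSn // pochS factS natrM natrB //.
  have := fact_neq0 (n - i); have : (n - i).+1%:R != 0 :> R by rewrite pnatr_eq0.
  by rewrite -natr1 natrB // -natr1 => h1 h2; field; rewrite h1 h2.
rewrite mulr0; move: lt_ni; rewrite leq_eqVlt => /predU1P[<-|lt_ni].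
  by rewrite subrr mul0r.
by rewrite leqNgt lt_ni mulr0.
Qed.

Lemma negbin_predr c n i :
  (n%:R - i%:R) * negbin c n i = (c + n%:R - i.+1%:R) * negbin c n i.+1.
Proof.
case: n => [|n].
  by rewrite (negbin_gt _ (ltn0Sn _)) /negbin; case: i => [|i] /=; rewrite ?subrr ?mul0r !mulr0.
by rewrite negbinS; congr (_ * _); rewrite -!natr1; ring.
Qed.

Lemma negbin_subn c N n l : (n <= N)%N -> (l <= N)%N ->
  negbin c (N - l) n = negbin c (N - n) l.
Proof.
move=> le_nN le_lN; rewrite /negbin subnAC.
by rewrite !leq_subRL // addnC.
Qed.

(* Pascal's rule, i.e. (1 - z) (1 - z)^(-c) = (1 - z)^(1 - c). *)
Lemma negbin_pascal c n i : negbin c n.+1 i - negbin c n i = negbin (c - 1) n.+1 i.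
Proof.
rewrite /negbin; have [le_in|lt_ni] := leqP i n; last first.
  rewrite subr0; move: lt_ni; rewrite leq_eqVlt => /predU1P[<-|lt_ni].
    by rewrite leqnn subnn !poch0.
  by rewrite leqNgt lt_ni.
rewrite (leq_trans le_in) // subSn //; move: (n - i)%N => k.
have -> : poch (c - 1) k.+1 = (c - 1) * poch c k.
  by rewrite -add1n pochD poch1 subrK.
have := fact_neq0 k; have : k.+1%:R != 0 :> R by rewrite pnatr_eq0.
by rewrite pochS factS natrM -natr1 => h1 h2; field; rewrite h1 h2.
Qed.

(** Reversing the last [l] factors of [poch c n] turns them into the Pochhammer symbol in the
    denominator. For l > n the truncation agrees with the zero of (-n)_l. *)
Lemma negbinE c n l : poch (1 - c - n%:R) l != 0 ->
  negbin c n l =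
  poch c n * poch (- n%:R) l / (n`!%:R * poch (1 - c - n%:R) l).
Proof.
move=> h0; rewrite /negbin; case: leqP => [le_ln|lt_nl]; last first.
  have /eqP -> : poch (- n%:R : R) l == 0 by rewrite poch_oppn_eq0.
  by rewrite mulr0 mul0r.
have S2 : (-1) ^+ l * (-1) ^+ l = 1 :> R by rewrite -expr2 sqrr_sign.
have E : poch c n = poch c (n - l) * ((-1) ^+ l * poch (1 - c - n%:R) l).
  have := poch_refl (c + (n - l)%:R) l.
  have -> : 1 - (c + (n - l)%:R) - l%:R = 1 - c - n%:R by rewrite natrB //; ring.
  by move=> ->; rewrite [X in _ = _ * X]mulrA S2 mul1r -pochD subnK.
have P := poch_oppn le_ln.
have -> : poch (- n%:R : R) l = (-1) ^+ l * n`!%:R / (n - l)`!%:R.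
  by rewrite -P mulfK // fact_neq0.
have := fact_neq0 n; have := fact_neq0 (n - l) => h1 h2.
(* [field] treats the sign as an unknown, so its square is inserted in place of 1. *)
rewrite E -[LHS]mul1r -[X in X * _]S2; field; by rewrite h0 h1 h2.
Qed.

(** Coefficient of z^k in (1-z)^(-x) (1-z)^(-y). Multiply by k + 1 = i + (k + 1 - i) and let each
    part raise the degree of one factor by [negbinS]; the multipliers x + i and y + k - i add up to
    x + y + k. *)
Lemma vandermonde x y k :
  \sum_(i < k.+1) negbin x i 0 * negbin y k i = negbin (x + y) k 0.
Proof.
elim: k => [|k IHk]; first by rewrite big_ord1 !negbinnn mulr1.
have k0 : k.+1%:R != 0 :> R by rewrite pnatr_eq0.
apply: (mulfI k0).
have := negbinS (x + y) k 0; rewrite !subr0 => ->; rewrite -IHk !mulr_sumr.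
rewrite (eq_bigr (fun i : 'I_k.+2 =>
    i%:R * negbin x i 0 * negbin y k.+1 i
  + negbin x i 0 * ((k.+1%:R - i%:R) * negbin y k.+1 i))); last first.
  by move=> i _; ring.
rewrite big_split /= [X in X + _]big_ord_recl [X in _ + X]big_ord_recr /=.
rewrite !mul0r add0r subrr mul0r mulr0 addr0.
rewrite -big_split /=; apply: eq_bigr => i _.
rewrite negbinS /bump /= add1n.
have := negbinS x i 0; rewrite !subr0 => ->.
have -> : negbin y k.+1 i.+1 = negbin y k i by rewrite /negbin ltnS subSS.
by ring.
Qed.

(** The coefficient of z^l in 2F1(A, B; D; z). *)
Definition hgcoef A B D l : R := poch A l * poch B l / (l`!%:R * poch D l).

Lemma hgcoefS A B D l : D + l%:R != 0 ->
  l.+1%:R * (D + l%:R) * hgcoef A B D l.+1 =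
  (A + l%:R) * (B + l%:R) * hgcoef A B D l.
Proof.
move=> h0; rewrite /hgcoef !pochS factS natrM !invfM.
have h1 : l.+1%:R != 0 :> R by rewrite pnatr_eq0.
(* With the inverse abstracted, [field] does not ask for [poch D l] to be nonzero. *)
move: (l.+1%:R) h1 (poch D l)^-1 => u h1 v.
by field; rewrite h0 h1 fact_neq0.
Qed.

(** Coefficient of z^M in Euler's transformation, the power of 1-z being moved to the side of 2F1(A,
    B; D; z). Both sides obey the same first-order recurrence in [M]. *)
Lemma saalschutz A B D M : (forall l, (l < M)%N -> D + l%:R != 0) ->
  \sum_(l < M.+1) hgcoef A B D l * negbin (D - A - B) M l =
  hgcoef (D - A) (D - B) D M.
Proof.
elim: M => [|M IHM] D0.
  by rewrite big_ord1 negbinnn mulr1 /hgcoef !poch0.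
have M0 : M.+1%:R * (D + M%:R) != 0 by rewrite mulf_neq0 ?pnatr_eq0 ?D0.
apply: (mulfI M0); rewrite hgcoefS ?D0 // -IHM; last first.
  by move=> l lt_lM; rewrite D0 // ltnW.
set s := D - A - B; rewrite !mulr_sumr.
(* With T M l the summand, Zeilberger's certificate:
   (M+1)(D+M) T (M+1) l - (D-A+M)(D-B+M) T M l = G l - G (l+1). *)
pose G l : R := l%:R * (D + l%:R - 1) * (hgcoef A B D l * negbin s M.+1 l).
have GS l : (l <= M)%N -> G l.+1 =
    (A + l%:R) * (B + l%:R) * (hgcoef A B D l * negbin s M l).
  move=> le_lM; rewrite /G.
  have -> : negbin s M.+1 l.+1 = negbin s M l by rewrite /negbin ltnS subSS.
  have := hgcoefS A B (D0 l le_lM); rewrite -natr1 => E.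
  by rewrite mulrA [in RHS]mulrA -E; congr (_ * _); ring.
(* This uses (M+1)(D+M) = l(D+l-1) + (M+1-l)(D+M+l). The first part vanishes at l = 0 and the second
   at l = M + 1, so after a shift both sums run over l <= M. *)
rewrite (eq_bigr (fun l : 'I_M.+2 => G l +
    (M.+1%:R - l%:R) * (D + M%:R + l%:R) * (hgcoef A B D l * negbin s M.+1 l)));
  last by move=> l _; rewrite /G -natr1; ring.
rewrite big_split /= [X in X + _]big_ord_recl [X in _ + X]big_ord_recr /=.
rewrite /G !mul0r add0r subrr !mul0r addr0 -big_split /=; apply: eq_bigr => l _.
have := GS l (leq_ord l); rewrite /G /bump /= add1n => ->.
have -> : (M.+1%:R - l%:R) * (D + M%:R + l%:R) *
    (hgcoef A B D l * negbin s M.+1 l) =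
    (D + M%:R + l%:R) * hgcoef A B D l *
    ((M.+1%:R - l%:R) * negbin s M.+1 l) by ring.
by rewrite negbinS /s; ring.
Qed.

(** Factor (1-z)^(-c) as (1-z)^(-s) (1-z)^(s-c) and absorb the first power by [saalschutz]. Only l <
    M is constrained, so D = -N is allowed as long as M <= N. *)
Lemma euler_coef A B D c M : (forall l, (l < M)%N -> D + l%:R != 0) ->
  \sum_(l < M.+1) hgcoef A B D l * negbin c M l =
  \sum_(l < M.+1) hgcoef (D - A) (D - B) D l * negbin (c - (D - A - B)) M l.
Proof.
move=> D0; set s := D - A - B.
pose P := \poly_(l < M.+1) hgcoef A B D l.
pose Q x := \poly_(l < M.+1) negbin x l 0.
have subn0E x k i : (i <= k)%N -> negbin x (k - i) 0 = negbin x k i.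
  by move=> le_ik; rewrite /negbin leq0n subn0 le_ik.
have QE x i : (i <= M)%N -> (Q x)`_i = negbin x i 0 by move=> ?; rewrite coef_poly ltnS ifT.
(* Truncation at degree [M] does not change the coefficient of degree [M], so associativity of the
   polynomial product regroups the triple convolution. *)
have : (P * Q s * Q (c - s))`_M = (P * (Q s * Q (c - s)))`_M by rewrite mulrA.
rewrite coefM [in RHS]coefM => E.
transitivity (\sum_(j < M.+1) P`_j * (Q s * Q (c - s))`_(M - j)).
  apply: eq_bigr => l _; rewrite coef_poly ltn_ord; congr (_ * _).
  rewrite -(subn0E _ _ _ (leq_ord l)) coefM -[in LHS](subrKC s c) -vandermonde.
  apply: eq_bigr => i _; have le_i := leq_ord i.
  have le_iM : (i <= M)%N := leq_trans le_i (leq_subr _ _).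
  have le_iM' : (M - l - i <= M)%N := leq_trans (leq_subr _ _) (leq_subr _ _).
  by rewrite (QE _ _ le_iM) (QE _ _ le_iM') subn0E.
rewrite -E; apply: eq_bigr => l _; have le_l := leq_ord l.
rewrite QE ?leq_subr // subn0E //; congr (_ * _).
rewrite coefM -saalschutz; last by move=> i lt_il; rewrite D0 // (leq_trans lt_il).
apply: eq_bigr => i _; have le_i := leq_ord i.
rewrite coef_poly ltnS (leq_trans le_i) // QE ?subn0E //.
exact: leq_trans (leq_subr _ _) le_l.
Qed.

End Pochhammer.

(** * Triangular systems and the entrywise action of Z, X and V *)

Section Bidiagonal.
Set Implicit Arguments.
Unset Strict Implicit.
Variable R : realType.
Implicit Types (N n : nat) (F v : nat -> R).

(** Forward substitution in the order of [r]: row [i] kills the entry [i] of v - w once all entries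
    of smaller rank are zero. The rank [r] lets one lemma serve lower triangular matrices (the index
    itself) and upper ones (N - i). *)
Lemma triangular_kernel_inj n (A : 'M[R]_n) (r : 'I_n -> nat) (m : 'I_n)
    (v w : 'cV[R]_n) :
  (forall i j, i != j -> (r i <= r j)%N -> A i j = 0) ->
  (forall i, i != m -> A i i != 0) ->
  A *m v = 0 -> A *m w = 0 -> v m 0 = w m 0 -> v = w.
Proof.
move=> Atri Adiag Av Aw vwm; apply/eqP; rewrite -subr_eq0; apply/eqP.
have : A *m (v - w) = 0 by rewrite mulmxBr Av Aw subrr.
have : (v - w) m 0 = 0 by rewrite !mxE vwm subrr.
move: (v - w) => u um Au.
suff u0 k i : (r i < k)%N -> u i 0 = 0.
  by apply/matrixP => i j; rewrite ord1 mxE (u0 (r i).+1).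
elim: k i => // k IHk i lt_ik.
have [->//|ne_im] := eqVneq i m.
have : (A *m u) i 0 = 0 by rewrite Au mxE.
rewrite mxE (bigD1 i) //= big1 ?addr0 => [|j ne_ji].
  by move/eqP; rewrite mulf_eq0 (negbTE (Adiag i ne_im)) => /eqP.
have [le_ij|lt_ji] := leqP (r i) (r j); first by rewrite Atri ?mul0r // eq_sym.
by rewrite IHk ?mulr0 // (leq_trans lt_ji).
Qed.

Lemma sum_delta n F (i : 'I_n) : \sum_(j < n) F j * (i == j)%:R = F i.
Proof.
rewrite (bigD1 i) //= eqxx mulr1 big1 ?addr0 // => j /negbTE.
by rewrite eq_sym => ->; rewrite mulr0.
Qed.

Lemma sum_delta_succ n F (i : nat) : (i < n)%N ->
  \sum_(j < n) F j * (i == j.+1 :> nat)%:R = (0 < i)%:R * F i.-1.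
Proof.
case: i => [|i] lt_in; first by rewrite mul0r big1 // => j _; rewrite mulr0.
by rewrite mul1r -(sum_delta F (Ordinal (ltnW lt_in))).
Qed.

Lemma sum_delta_pred N F (i : nat) :
  \sum_(j < N.+1) F j * (i.+1 == j :> nat)%:R = (i < N)%:R * F i.+1.
Proof.
case: ltnP => [lt_iN|le_Ni].
  by rewrite mul1r -(sum_delta F (Ordinal (lt_iN : (i.+1 < N.+1)%N))).
by rewrite mul0r big1 // => j _; rewrite gtn_eqF ?mulr0 // ltnS (leq_trans (leq_ord j)).
Qed.

Variables (N : nat) (alpha beta : R) (a_ : nat -> R).
Hypothesis aN : a_ N = 0.
Implicit Types (i : 'I_N.+1).

Let mulaN i x : (i < N)%:R * (a_ i * x) = a_ i * x.
Proof.
have [_|le_Ni] := ltnP i N; first by rewrite mul1r.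
by rewrite (_ : nat_of_ord i = N) ?aN ?mul0r ?mulr0 //; apply/eqP; rewrite eqn_leq leq_ord.
Qed.

(** In this and the next five lemmas [v] is a function on all of [nat]. The absent neighbours are
    removed by the guard 0 < i, by [a_ N = 0], or, for V and its transpose, by the factors N - i and
    i. *)
Lemma opZ_col v i : (opZ N a_ *m \col_j v j) i 0 =
  - v i + (0 < i)%:R * (a_ i.-1 * v i.-1).
Proof.
rewrite mxE -(sum_delta v i) -(sum_delta_succ (fun j => a_ j * v j) (ltn_ord i)).
by rewrite -sumrN -big_split /=; apply: eq_bigr => j _; rewrite !mxE; ring.
Qed.

Lemma opZT_col v i : ((opZ N a_)^T *m \col_j v j) i 0 =
  - v i + a_ i * v i.+1.
Proof.
rewrite mxE -(sum_delta v i) -mulaN -(sum_delta_pred N (fun j => a_ i * v j)).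
rewrite -sumrN -big_split /=; apply: eq_bigr => j _.
by rewrite !mxE (eq_sym i j) (eq_sym i.+1 (j : nat)); ring.
Qed.

Lemma opX_col v i : (opX N a_ alpha beta *m \col_j v j) i 0 =
  (i%:R - alpha) * v i - (0 < i)%:R * (a_ i.-1 * (i.-1%:R - beta) * v i.-1).
Proof.
rewrite mxE -(sum_delta (fun j => (j%:R - alpha) * v j)).
rewrite -(sum_delta_succ (fun j => a_ j * (j%:R - beta) * v j) (ltn_ord i)).
by rewrite -sumrB; apply: eq_bigr => j _; rewrite !mxE; ring.
Qed.

Lemma opXT_col v i : ((opX N a_ alpha beta)^T *m \col_j v j) i 0 =
  (i%:R - alpha) * v i - a_ i * ((i%:R - beta) * v i.+1).
Proof.
rewrite mxE -(sum_delta (fun j => (i%:R - alpha) * v j)) -mulaN.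
rewrite -(sum_delta_pred N (fun j => a_ i * ((i%:R - beta) * v j))).
rewrite -sumrB; apply: eq_bigr => j _.
by rewrite !mxE (eq_sym i j) (eq_sym i.+1 (j : nat)); ring.
Qed.

Lemma opV_col v i : (opV N a_ beta *m \col_j v j) i 0 =
  mu beta i * v i - i.+1%:R * (N%:R - i%:R) / a_ i * v i.+1.
Proof.
have -> : i.+1%:R * (N%:R - i%:R) / a_ i * v i.+1 =
    (i < N)%:R * (i.+1%:R * (N.+1%:R - i.+1%:R) / a_ i.+1.-1 * v i.+1).
  have -> : N.+1%:R - i.+1%:R = N%:R - i%:R :> R by rewrite -!natr1; ring.
  have [_|le_Ni] := ltnP i N; first by rewrite mul1r.
  by rewrite (_ : nat_of_ord i = N) ?subrr ?mulr0 ?mul0r //; apply/eqP; rewrite eqn_leq leq_ord.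
rewrite mxE -(sum_delta (fun j => mu beta j * v j)).
rewrite -(sum_delta_pred N (fun j => j%:R * (N.+1%:R - j%:R) / a_ j.-1 * v j)).
by rewrite -sumrB; apply: eq_bigr => j _; rewrite !mxE /mu; ring.
Qed.

Lemma opVT_col v i : ((opV N a_ beta)^T *m \col_j v j) i 0 =
  mu beta i * v i - i%:R * (N.+1%:R - i%:R) / a_ i.-1 * v i.-1.
Proof.
have -> : i%:R * (N.+1%:R - i%:R) / a_ i.-1 * v i.-1 =
    (0 < i)%:R * (i%:R * (N.+1%:R - i%:R) / a_ i.-1 * v i.-1).
  by case: (nat_of_ord i) => [|k]; rewrite ?mul1r // !mul0r.
rewrite mxE -(sum_delta (fun j => mu beta i * v j)).
rewrite -(sum_delta_succ (fun j => i%:R * (N.+1%:R - i%:R) / a_ i.-1 * v j) (ltn_ord i)).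
rewrite -sumrB; apply: eq_bigr => j _.
by rewrite !mxE (eq_sym i j) (eq_sym (i : nat) j.+1) /mu; ring.
Qed.
End Bidiagonal.

(** * The Hahn-type series as a convolution, and Pochhammer symbols of signed index *)

Section Hahn.
Set Implicit Arguments.
Unset Strict Implicit.
Variable R : realType.
Implicit Types (x b c B D : R) (m n l N K L : nat).

Lemma hgcoef_oppn_gt n l B D : (n < l)%N -> hgcoef (- n%:R) B D l = 0.
Proof.
move=> lt_nl; have /eqP h0 : poch (- n%:R : R) l == 0 by rewrite poch_oppn_eq0.
by rewrite /hgcoef h0 !mul0r.
Qed.

Lemma sum_ord_trunc K L (F : nat -> R) : (K <= L)%N ->
  (forall l, (K < l)%N -> F l = 0) ->
  \sum_(l < L.+1) F l = \sum_(l < K.+1) F l.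
Proof.
move=> le_KL F0; rewrite [RHS](big_ord_widen L.+1) ?ltnS // [RHS]big_mkcond /=.
by apply: eq_bigr => l _; rewrite ltnS; case: leqP => // /F0.
Qed.

(** By [negbinE], (-n)_l / (1-c-n)_l together with the prefactor (c)_n / n! is a binomial
    coefficient; the other factors of the summand form [hgcoef]. *)
Lemma hahnU_negbin m n c b N : hahnU_defined m n%:R (1 - c) b N ->
  poch c n / n`!%:R * hahnU m n%:R (1 - c) b N =
  (-1) ^+ m * poch (- N%:R) m / poch (b + 1) m *
  \sum_(l < m.+1)
    hgcoef (- m%:R) (b + m%:R - N%:R) (- N%:R) l * negbin c n l.
Proof.
case=> _ den0; rewrite /hahnU mulrCA; congr (_ * _).
rewrite mulr_sumr; apply: eq_bigr => l _.
have := den0 l (leq_ord l); rewrite !mulf_eq0 !negb_or -andbA.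
case/and3P=> l0 N0 c0; rewrite negbinE // /hgcoef; field.
by rewrite l0 N0 c0 fact_neq0.
Qed.

Lemma pochz_subn2 x m N : (m <= N)%N -> pochz x (N%:Z - (2 * m)%N%:Z) != 0 ->
  poch (x - m%:R) (N - m) =
  poch (x - m%:R) m * pochz x (N%:Z - (2 * m)%N%:Z).
Proof.
move=> le_mN; have [le_2mN|lt_N2m] := leqP (2 * m) N.
  rewrite subzn //= => _.
  have -> : (N - m = m + (N - 2 * m))%N by lia.
  by rewrite pochD subrK.
(* [Negz k] stands for -(k+1), hence the predecessor. Here [pochz] is the inverse of the last 2m - N
   factors of (x-m)_m, nonzero by hypothesis. *)
have -> : N%:Z - (2 * m)%N%:Z = Negz (2 * m - N).-1 by lia.
rewrite /= prednK ?subn_gt0 // invr_eq0 => k0.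
have -> : poch (x - m%:R) m = poch (x - m%:R) (N - m + (2 * m - N)).
  by congr poch; lia.
rewrite pochD.
have -> : x - m%:R + (N - m)%:R = x - (2 * m - N)%:R.
  by rewrite natrB // natrB 1?ltnW // natrM; ring.
by rewrite mulfK.
Qed.
End Hahn.

(** * Uniqueness and closed forms of the four families of vectors *)

Section Eigenvectors.
Set Implicit Arguments.
Unset Strict Implicit.
Variables (R : realType) (N : nat) (alpha beta : R) (a_ : nat -> R).
Hypotheses (a_neq0 : forall n : nat, (n < N)%N -> a_ n != 0) (aN : a_ N = 0).
Let a := alpha - beta.
Let b : R := N%:R - 2 * beta - 1.
Local Notation A k := (\prod_(0 <= i < k) a_ i).
Implicit Types (m n i : 'I_N.+1) (v w : 'cV[R]_N.+1).

Lemma aprod_neq0 k : (k <= N)%N -> A k != 0.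
Proof.
move=> le_kN; rewrite big_mkord; apply/prodf_neq0 => i _.
by rewrite a_neq0 // (leq_trans (ltn_ord i)).
Qed.

Lemma aprod_ratio m n :
  (\prod_(n <= i < N) a_ i) / (\prod_(m <= i < N) a_ i) = A m / A n.
Proof.
have E k : (k <= N)%N -> \prod_(k <= i < N) a_ i = A N / A k.
  by move=> le_kN; rewrite (big_cat_nat (leq0n k) le_kN) /= mulrAC divff ?mul1r ?aprod_neq0.
have [Nm Nn] := (aprod_neq0 (leq_ord m), aprod_neq0 (leq_ord n)).
rewrite (E m) ?(E n) ?leq_ord //; field.
by rewrite Nm Nn aprod_neq0.
Qed.

Let ltN_or_eq i : (i < N)%N \/ nat_of_ord i = N.
Proof. by have := leq_ord i; rewrite leq_eqVlt => /predU1P[|]; [right|left]. Qed.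

(** This factorization makes the recurrences for V hypergeometric: its two factors supply the two
    upper parameters of [hgcoef]. *)
Lemma mu_sub (j k : nat) :
  mu beta j - mu beta k = (k%:R - j%:R) * (j%:R + k%:R + b - N%:R) :> R.
Proof. by rewrite /mu /b; ring. Qed.

(** V is upper bidiagonal, hence the rank N - i. Off [m], the diagonal of V - mu_m is nonzero
    because the eigenvalues are distinct. *)
Lemma eigenV_unique m v w :
  (forall i, i != m -> mu beta i != mu beta m :> R) ->
  opV N a_ beta *m v = mu beta m *: v ->
  opV N a_ beta *m w = mu beta m *: w -> v m 0 = w m 0 -> v = w.
Proof.
move=> mu_neq Vv Vw; pose M := opV N a_ beta - (mu beta m)%:M.
apply: (@triangular_kernel_inj _ _ M (fun i => N - i)%N m).
- move=> i j ne_ij /=; rewrite (leq_sub2lE _ (leq_ord j)) => le_ji.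
  by rewrite !mxE (negbTE ne_ij) gtn_eqF ?ltnS // !mulr0 mulr0n !subrr.
- by move=> i /mu_neq; rewrite -subr_eq0 !mxE eqxx gtn_eqF // mulr0 subr0 !mulr1 mulr1n.
- by rewrite mulmxBl Vv mul_scalar_mx subrr.
- by rewrite mulmxBl Vw mul_scalar_mx subrr.
Qed.

Lemma eigenVT_unique m v w :
  (forall i, i != m -> mu beta i != mu beta m :> R) ->
  (opV N a_ beta)^T *m v = mu beta m *: v ->
  (opV N a_ beta)^T *m w = mu beta m *: w -> v m 0 = w m 0 -> v = w.
Proof.
move=> mu_neq Vv Vw; pose M := (opV N a_ beta)^T - (mu beta m)%:M.
apply: (@triangular_kernel_inj _ _ M val m).
- move=> i j ne_ij le_ij.
  by rewrite !mxE (negbTE ne_ij) eq_sym (negbTE ne_ij) gtn_eqF ?ltnS // !mulr0 mulr0n !subrr.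
- by move=> i /mu_neq; rewrite -subr_eq0 !mxE eqxx gtn_eqF // mulr0 subr0 !mulr1 mulr1n.
- by rewrite mulmxBl Vv mul_scalar_mx subrr.
- by rewrite mulmxBl Vw mul_scalar_mx subrr.
Qed.

(** The pencil X - lambda_n Z has diagonal entries i - n, so no genericity of the parameters
    enters. *)
Lemma eigenXZ_unique n v w :
  opX N a_ alpha beta *m v = lambda alpha n *: (opZ N a_ *m v) ->
  opX N a_ alpha beta *m w = lambda alpha n *: (opZ N a_ *m w) ->
  v n 0 = w n 0 -> v = w.
Proof.
move=> Xv Xw; pose M := opX N a_ alpha beta - lambda alpha n *: opZ N a_.
apply: (@triangular_kernel_inj _ _ M val n).
- move=> i j ne_ij le_ij.
  by rewrite !mxE (negbTE ne_ij) ltn_eqF ?ltnS // !mulr0 ?mulr0n; ring.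
- move=> i ne_in; rewrite !mxE eqxx ltn_eqF // !mulr0 !mulr1 ?mulr1n /lambda.
  rewrite (_ : _ - _ = i%:R - n%:R); last by ring.
  by rewrite subr_eq0 eqr_nat.
- by rewrite mulmxBl Xv -scalemxAl subrr.
- by rewrite mulmxBl Xw -scalemxAl subrr.
Qed.

Lemma eigenXZT_unique n v w :
  (opX N a_ alpha beta)^T *m v = lambda alpha n *: ((opZ N a_)^T *m v) ->
  (opX N a_ alpha beta)^T *m w = lambda alpha n *: ((opZ N a_)^T *m w) ->
  v n 0 = w n 0 -> v = w.
Proof.
move=> Xv Xw; pose M := (opX N a_ alpha beta)^T - lambda alpha n *: (opZ N a_)^T.
apply: (@triangular_kernel_inj _ _ M (fun i => N - i)%N n).
- move=> i j ne_ij /=; rewrite (leq_sub2lE _ (leq_ord j)) => le_ji.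
  by rewrite !mxE eq_sym (negbTE ne_ij) ltn_eqF ?ltnS // !mulr0 ?mulr0n; ring.
- move=> i ne_in; rewrite !mxE eqxx ltn_eqF // !mulr0 !mulr1 ?mulr1n /lambda.
  rewrite (_ : _ - _ = i%:R - n%:R); last by ring.
  by rewrite subr_eq0 eqr_nat.
- by rewrite mulmxBl Xv -scalemxAl subrr.
- by rewrite mulmxBl Xw -scalemxAl subrr.
Qed.

(** The products [A] absorb the constants [a_]; what remains of row [i] is the term ratio [hgcoefS].
    The constant in the middle is the inverse of [hgcoef] at [m], which gives the normalization. *)
Lemma eigenV_explicit m v :
  (forall i, i != m -> mu beta i != mu beta m :> R) ->
  poch (b + m%:R - N%:R) m != 0 ->
  opV N a_ beta *m v = mu beta m *: v -> v m 0 = 1 ->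
  v = \col_(i < N.+1) (A i / A m *
    ((-1) ^+ m * poch (- N%:R) m / poch (b + m%:R - N%:R) m) *
    hgcoef (- m%:R) (b + m%:R - N%:R) (- N%:R) i).
Proof.
move=> mu_neq P0 Vv vm; set h := hgcoef _ _ _; set C := _ / poch _ _.
apply: (eigenV_unique mu_neq Vv); last first.
  rewrite vm mxE /h /hgcoef /C divff ?aprod_neq0 ?leq_ord //.
  have := poch_oppn R (leqnn m); rewrite subnn mulr1 => ->.
  have N0 : poch (- N%:R : R) m != 0 by rewrite poch_oppn_eq0 -leqNgt leq_ord.
  rewrite -[LHS]mul1r -[X in X * _ = _](sqrr_sign R m); field.
  by rewrite N0 P0 fact_neq0.
apply/matrixP => i j; rewrite ord1 (opV_col beta a_ (fun i : nat => A i / A m * C * h i)) !mxE.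
apply/eqP; rewrite subr_eq addrC -subr_eq -mulrBl mu_sub; apply/eqP.
(* The last row has no successor: either m = N and the eigenvalues agree, or the series has already
   terminated. *)
have [lt_iN|->] := ltN_or_eq i; last first.
  have [->|ne_mN] := eqVneq (m : nat) N; first by rewrite !subrr !(mul0r, mulr0).
  rewrite /h hgcoef_oppn_gt ?subrr ?(mul0r, mulr0) //.
  by rewrite ltn_neqAle ne_mN leq_ord.
have D0 : - N%:R + i%:R != 0 :> R by rewrite addrC subr_eq0 eqr_nat ltn_eqF.
have a0 := a_neq0 lt_iN; have Am0 := aprod_neq0 (leq_ord m).
have E := hgcoefS (- m%:R) (b + m%:R - N%:R) D0.
rewrite big_nat_recr //=.
have -> : i.+1%:R * (N%:R - i%:R) / a_ i * (A i * a_ i / A m * C * h i.+1) =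
    - (A i / A m * C) * (i.+1%:R * (- N%:R + i%:R) * h i.+1).
  by field; rewrite a0 Am0.
by rewrite E -/h; field.
Qed.

(** The transposed vector lives on i >= m, so its series is read downwards from [N]: in j = N - i
    the factors of [mu_sub] become -(N-m) + j and -b-m + j. *)
Lemma eigenVT_explicit m v :
  (forall i, i != m -> mu beta i != mu beta m :> R) ->
  poch (- b - m%:R) (N - m) != 0 ->
  (opV N a_ beta)^T *m v = mu beta m *: v -> v m 0 = 1 ->
  let h := hgcoef (- (N - m)%:R) (- b - m%:R) (- N%:R) in
  v = \col_(i < N.+1) (A m / A i * (h (N - i)%N / h (N - m)%N)).
Proof.
move=> mu_neq P0 Vv vm h.
have le_mN := leq_ord m; have Am0 := aprod_neq0 le_mN.
apply: (eigenVT_unique mu_neq Vv); last first.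
  rewrite vm mxE !divff ?mulr1 // /h /hgcoef !mulf_neq0 ?invr_eq0 ?mulf_neq0 //.
  - by rewrite poch_oppn_eq0 ltnn.
  - exact: fact_neq0.
  - by rewrite poch_oppn_eq0 -leqNgt leq_subr.
apply/matrixP => i j; rewrite ord1.
rewrite (opVT_col beta a_ (fun i : nat => A m / A i * (h (N - i)%N / h (N - m)%N))) !mxE.
apply/eqP; rewrite subr_eq addrC -subr_eq -mulrBl mu_sub; apply/eqP.
have := leq_ord i; case: (nat_of_ord i) => [|k] lt_kN.
  rewrite !mul0r subn0 /h.
  have [->|m0] := posnP m; first by rewrite subrr !mul0r.
  by rewrite hgcoef_oppn_gt ?mul0r ?mulr0 // ltn_subrL m0 (leq_trans m0).
have E0 : (N - k = (N - k.+1).+1)%N by lia.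
have D0 : - N%:R + (N - k.+1)%:R != 0 :> R.
  by rewrite addrC subr_eq0 eqr_nat; lia.
have E := hgcoefS (- (N - m)%:R) (- b - m%:R) D0.
have a0 := a_neq0 lt_kN; have Ak0 := aprod_neq0 (ltnW lt_kN).
rewrite /= big_nat_recr //= E0 -/h in E *.
move: (h (N - m)%N)^-1 => w.
have -> : k.+1%:R * (N.+1%:R - k.+1%:R) / a_ k *
    (A m / A k * (h (N - k.+1).+1 * w)) =
    - (A m / (A k * a_ k) * w) *
    ((N - k.+1).+1%:R * (- N%:R + (N - k.+1)%:R) * h (N - k.+1).+1).
  rewrite -natr1 [(N - k.+1).+1%:R]mulrS natrB // -[k.+1%:R]natr1; field.
  by rewrite a0 Ak0.
rewrite E !natrB // -[k.+1%:R]natr1; field.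
by rewrite a0 Ak0.
Qed.

(** Up to the products [A], row k + 1 of the pencil is [negbinS] with c = a. *)
Lemma eigenXZ_explicit n v :
  opX N a_ alpha beta *m v = lambda alpha n *: (opZ N a_ *m v) -> v n 0 = 1 ->
  v = \col_(i < N.+1) (A i / A n * negbin a i n).
Proof.
move=> Xv vn; apply: (eigenXZ_unique Xv); last first.
  by rewrite vn mxE negbinnn mulr1 divff // aprod_neq0 // leq_ord.
apply/matrixP => i j; rewrite ord1 [RHS]mxE (opX_col _ _ _ (fun i : nat => A i / A n * negbin a i n)).
rewrite (opZ_col a_ (fun i : nat => A i / A n * negbin a i n)).
case: (nat_of_ord i) => [|k] /=.
  have [->|n0] := posnP n; first by rewrite /lambda; ring.
  by rewrite negbin_gt //; ring.
have E := negbinS a k n.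
rewrite big_nat_recr //= !mul1r; apply/eqP; rewrite -subr_eq0.
rewrite (_ : _ - _ = A k * a_ k / A n * ((k.+1%:R - n%:R) * negbin a k.+1 n
  - (a + k%:R - n%:R) * negbin a k n)); first by rewrite E subrr mulr0.
by rewrite /lambda /a; ring.
Qed.

(** Up to the products [A], Z multiplies the generating series by -(1-z), which lowers the exponent
    parameter from a to a - 1. *)
Lemma opZ_eigenXZ n i :
  (opZ N a_ *m \col_(i < N.+1) (A i / A n * negbin a i n)) i 0 =
  - (A i / A n * negbin (a - 1) i n).
Proof.
rewrite (opZ_col a_ (fun i : nat => A i / A n * negbin a i n)).
case: (nat_of_ord i) => [|k] /=.
  rewrite mul0r addr0; congr (- (_ * _)).
  by case: (nat_of_ord n) => [|l]; rewrite ?negbinnn // !negbin_gt.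
by rewrite big_nat_recr //= -negbin_pascal; ring.
Qed.

(** The transposed pencil steps in the lower index, so [negbin_predr] takes over, and matching a + i
    - n with its factor gives c = 1 - a. *)
Lemma eigenXZT_explicit n v :
  (opX N a_ alpha beta)^T *m v = lambda alpha n *: ((opZ N a_)^T *m v) ->
  v n 0 = 1 ->
  v = \col_(i < N.+1) (A n / A i * negbin (1 - a) n i).
Proof.
move=> Xv vn; apply: (eigenXZT_unique Xv); last first.
  by rewrite vn mxE negbinnn mulr1 divff // aprod_neq0 // leq_ord.
apply/matrixP => i j; rewrite ord1 [RHS]mxE.
rewrite (opXT_col _ _ aN (fun i : nat => A n / A i * negbin (1 - a) n i)).
rewrite (opZT_col aN (fun i : nat => A n / A i * negbin (1 - a) n i)).
have [lt_iN|->] := ltN_or_eq i; last first.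
  rewrite aN !mul0r; have [->|ne_nN] := eqVneq (n : nat) N.
    by rewrite /lambda; ring.
  by rewrite negbin_gt ?ltn_neqAle ?ne_nN ?leq_ord //; ring.
have E := negbin_predr (1 - a) n i.
have a0 := a_neq0 lt_iN; have Ai0 := aprod_neq0 (ltnW lt_iN).
rewrite big_nat_recr //=; apply/eqP; rewrite -subr_eq0.
rewrite (_ : _ - _ = - (A n / A i) * ((n%:R - i%:R) * negbin (1 - a) n i
  - (1 - a + n%:R - i.+1%:R) * negbin (1 - a) n i.+1)).
  by rewrite E subrr mulr0.
by rewrite /lambda /a -natr1; field; rewrite a0 Ai0.
Qed.
End Eigenvectors.

(** * The two overlap formulas *)

Theorem proposition4 (R : realType) (N : nat) (alpha beta : R)
    (a_ : nat -> R)
    (e es d ds : 'I_N.+1 -> 'cV[R]_N.+1) :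
  let Z := opZ N a_ in
  let X := opX N a_ alpha beta in
  let V := opV N a_ beta in
  let a := alpha - beta in
  let b := N%:R - 2 * beta - 1 in
  (forall n : nat, (n < N)%N -> a_ n != 0) ->
  a_ N = 0 ->
  (forall n : 'I_N.+1, V *m e n = mu beta n *: e n /\ e n n 0 = 1) ->
  (forall n : 'I_N.+1, V^T *m es n = mu beta n *: es n /\ es n n 0 = 1) ->
  (forall n : 'I_N.+1,
     X *m d n = lambda alpha n *: (Z *m d n) /\ d n n 0 = 1) ->
  (forall n : 'I_N.+1,
     X^T *m ds n = lambda alpha n *: (Z^T *m ds n) /\ ds n n 0 = 1) ->
  (forall m n : 'I_N.+1, m != n -> mu beta m != mu beta n) ->
  (forall m : 'I_N.+1, poch (m%:R + b - N%:R) m != 0) ->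
  (forall m : 'I_N.+1, pochz (- b) (N%:Z - (2 * m)%N%:Z) != 0) ->
  (forall m n : 'I_N.+1, hahnU_defined m n%:R a b N) ->
  (forall m n : 'I_N.+1, hahnV_defined m n%:R a b N) ->
  forall m n : 'I_N.+1,
    braket (e m) (ds n) =
      (\prod_(0 <= i < n) a_ i) / (\prod_(0 <= i < m) a_ i) *
      (poch (1 - a) n * poch (1 + b) m
       / (n`!%:R * poch (m%:R + b - N%:R) m)) *
      hahnU m n%:R a b N
    /\
    braket (es m) (Z *m d n) =
      - ((\prod_(n <= i < N) a_ i) / (\prod_(m <= i < N) a_ i)) *
      (poch (m%:R + 1) (N - m) * poch (a - b - 1) (N - n)
       / ((N - n)`!%:R * poch (- N%:R) m
          * pochz (- b) (N%:Z - (2 * m)%N%:Z))) *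
      hahnV m n%:R a b N.
Proof.
move=> Z X V a b a_neq0 aN eP esP dP dsP mu_neq pochP pochzP hU hV m n.
have mu_neq' i : i != m -> mu beta i != mu beta m := mu_neq i m.
have [le_mN le_nN] := (leq_ord m, leq_ord n).
have poch_bm : poch (b + m%:R - N%:R) m != 0.
  by have := pochP m; rewrite [m%:R + b]addrC.
have [b1_neq0 _] := hU m n.
split.
  have [Ve em] := eP m; have [Xd dn] := dsP n.
  rewrite (eigenV_explicit a_neq0 mu_neq' poch_bm Ve em).
  rewrite (eigenXZT_explicit a_neq0 aN Xd dn) -/a -/b.
  have U := @hahnU_negbin R m n (1 - a) b N.
  rewrite opprB addrC subrK in U; have {}U := U (hU m n).
  set h := hgcoef _ _ _ in U *.
  (* The vector e_m has no components beyond [m], so the overlap stops where the Hahn series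
     does. *)
  have E : \sum_(l < N.+1) h l * negbin (1 - a) n l =
           \sum_(l < m.+1) h l * negbin (1 - a) n l.
    apply: (sum_ord_trunc (F := fun l => h l * negbin (1 - a) n l)) => // l lt_ml.
    by rewrite /h hgcoef_oppn_gt ?mul0r.
  set P := \prod_(0 <= i < n) a_ i; set Q := \prod_(0 <= i < m) a_ i.
  transitivity (P / Q * ((-1) ^+ m * poch (- N%:R) m / poch (b + m%:R - N%:R) m) *
    \sum_(l < N.+1) h l * negbin (1 - a) n l).
    rewrite /braket mxE mulr_sumr; apply: eq_bigr => l _; rewrite !mxE.
    have := aprod_neq0 a_neq0 (leq_ord l); have := aprod_neq0 a_neq0 le_mN.
    by rewrite -/Q => Q0 l0; field; rewrite Q0 l0 poch_bm.
  rewrite E; move/(congr1 (fun x => P / Q * (poch (b + 1) m / poch (b + m%:R - N%:R) m) * x)): U.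
  move: (\sum_(_ < _) _) (hahnU _ _ _ _ _) => S U E2.
  rewrite [m%:R + b]addrC [1 + b]addrC.
  have Q0 : Q != 0 := aprod_neq0 a_neq0 le_mN.
  transitivity (P / Q * (poch (b + 1) m / poch (b + m%:R - N%:R) m) *
    ((-1) ^+ m * poch (- N%:R) m / poch (b + 1) m * S)).
    by field; rewrite Q0 b1_neq0 poch_bm.
  rewrite -E2; field.
  by rewrite Q0 fact_neq0 poch_bm.
have [Ve em] := esP m; have [Xd dn] := dP n.
have pz := pochzP m.
have split_pz := pochz_subn2 le_mN pz.
have refl_b := poch_refl (b + 1) m.
rewrite (_ : 1 - (b + 1) - m%:R = - b - m%:R) in refl_b; last by ring.
(* This symbol equals (-1)^m (b+1)_m (-b)_(N-2m), whose factors are nonzero by assumption. *)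
have bm0 : poch (- b - m%:R) (N - m) != 0.
  by rewrite split_pz mulf_neq0 // refl_b mulf_neq0 ?signr_eq0.
rewrite (eigenVT_explicit a_neq0 mu_neq' bm0 Ve em).
rewrite (eigenXZ_explicit a_neq0 Xd dn) -/a -/b.
set h := hgcoef _ _ _.
have := @hahnU_negbin R m (N - n) (a - b - 1) b N.
rewrite natrB // (_ : 1 - (a - b - 1) = b + 2 - a); last by ring.
move/(_ (hV m n)); rewrite -/(hahnV _ _ _ _ _).
(* This evaluates the normalization of the transposed eigenvector; it yields the constants
   (m+1)_(N-m) and (-b)_(N-2m) of the formula. *)
have hm : h (N - m)%N * (poch (m%:R + 1) (N - m) * (-1) ^+ m) =
    poch (b + 1) m * pochz (- b) (N%:Z - (2 * m)%N%:Z).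
  rewrite /h /hgcoef split_pz refl_b.
  have := poch_oppn R (leqnn (N - m)); rewrite subnn mulr1 => ->.
  have := poch_oppn R (leq_subr m N); rewrite subKn // -(poch_fact R le_mN).
  move=> /(canRL (mulfK (fact_neq0 R m))) ->.
  have N0 : poch (m%:R + 1 : R) (N - m) != 0.
    have := fact_neq0 R N; rewrite -(poch_fact R le_mN) mulf_eq0 negb_or.
    by case/andP.
  rewrite -[RHS]mul1r -[X in _ = X * _](sqrr_sign R m); field.
  by rewrite !fact_neq0 N0 signr_eq0.
(* [euler_coef] with M = N - n and D = -N, where D - A - B = b. The range is first cut to N - n,
   where the lemma applies, then widened to N and cut to m by vanishing terms. *)
have euler : \sum_(l < N.+1) h l * negbin (a - 1) (N - n) l =
    \sum_(l < m.+1) hgcoef (- m%:R) (b + m%:R - N%:R) (- N%:R) l *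
      negbin (a - b - 1) (N - n) l.
  rewrite (sum_ord_trunc (K := N - n) (F := fun l => h l * negbin (a - 1) (N - n) l)) ?leq_subr //; last first.
    by move=> l lt_l; rewrite negbin_gt ?mulr0.
  rewrite /h euler_coef; last first.
    move=> l lt_l; rewrite addrC subr_eq0 eqr_nat ltn_eqF //.
    exact: leq_trans lt_l (leq_subr _ _).
  have -> : - N%:R - - (N - m)%:R = - m%:R :> R by rewrite natrB //; ring.
  have -> : - N%:R - (- b - m%:R) = b + m%:R - N%:R by ring.
  have -> : a - 1 - (- m%:R - (- b - m%:R)) = a - b - 1 by ring.
  set F := fun l => hgcoef (- m%:R) (b + m%:R - N%:R) (- N%:R) l * negbin (a - b - 1) (N - n) l.
  rewrite -[LHS](sum_ord_trunc (L := N) (F := F)) ?leq_subr //; last first.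
    by move=> l lt_l; rewrite /F negbin_gt ?mulr0.
  apply: (sum_ord_trunc (F := F)) => // l lt_l.
  by rewrite /F hgcoef_oppn_gt ?mul0r.
rewrite -euler (aprod_ratio a_neq0).
set P := \prod_(0 <= i < m) a_ i; set Q := \prod_(0 <= i < n) a_ i.
have Q0 : Q != 0 := aprod_neq0 a_neq0 le_nN.
have N0 : poch (- N%:R : R) m != 0 by rewrite poch_oppn_eq0 -leqNgt.
have h0 : h (N - m)%N != 0.
  by move: hm => /eqP; apply: contraTneq => ->; rewrite mul0r eq_sym mulf_neq0.
set S := \sum_(l < N.+1) _ => E.
transitivity (- (P / Q) / h (N - m)%N * S).
  (* Summing from the top index turns N - l into the summation variable of [h]; [negbin_subn] then
     exchanges the roles of [l] and [n]. *)
  rewrite /braket mxE (reindex_inj rev_ord_inj) mulr_sumr; apply: eq_bigr => l _.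
  rewrite /Z (opZ_eigenXZ alpha beta) !mxE /= subSS.
  have le_lN := leq_ord l; rewrite (negbin_subn _ le_nN le_lN) subKn //.
  have := aprod_neq0 a_neq0 (leq_subr l N) => l0.
  by rewrite -/P -/Q; field; rewrite Q0 l0 h0.
have -> : (h (N - m)%N)^-1 = poch (m%:R + 1) (N - m) * (-1) ^+ m /
    (poch (b + 1) m * pochz (- b) (N%:Z - (2 * m)%N%:Z)).
  by apply: (mulfI h0); rewrite [RHS]mulrA hm !divff // mulf_neq0.
transitivity (- (P / Q) * (poch (m%:R + 1) (N - m) /
  (poch (- N%:R) m * pochz (- b) (N%:Z - (2 * m)%N%:Z))) *
  ((-1) ^+ m * poch (- N%:R) m / poch (b + 1) m * S)).
  by field; rewrite Q0 N0 b1_neq0 pz.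
by rewrite -E; field; rewrite Q0 N0 pz fact_neq0.
Qed.
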